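(* Let $q\in\mathbb{C}\setminus\{0\}$ be not a root of unity, let $\mathcal{A}_q=\mathcal{A}_q(x,\xi,\theta,z)$ be the algebra of polynomials on the double-graded quantum superplane with the differential calculus described in the context, and let $\partial_x,\partial_\xi,\partial_\theta,\partial_z$ be the partial derivatives. The commutation rules between the partial derivatives and the differentials are: $$\partial_x\,\mathrm{d}x=\mathrm{d}x\,\partial_x,\quad \partial_x\,\mathrm{d}\xi=q^{-1}\mathrm{d}\xi\,\partial_x,\quad \partial_x\,\mathrm{d}\theta=q^{-1}\mathrm{d}\theta\,\partial_x,\quad \partial_x\,\mathrm{d}z=\mathrm{d}z\,\partial_x,$$ $$\partial_\xi\,\mathrm{d}x=q\,\mathrm{d}x\,\partial_\xi,\quad \partial_\xi\,\mathrm{d}\xi=-\mathrm{d}\xi\,\partial_\xi,\quad \partial_\xi\,\mathrm{d}\theta=\mathrm{d}\theta\,\partial_\xi,\quad \partial_\xi\,\mathrm{d}z=-q\,\mathrm{d}z\,\partial_\xi,$$ $$\partial_\theta\,\mathrm{d}x=q\,\mathrm{d}x\,\partial_\theta,\quad \partial_\theta\,\mathrm{d}\theta=-\mathrm{d}\theta\,\partial_\theta,\quad \partial_\theta\,\mathrm{d}\xi=\mathrm{d}\xi\,\partial_\theta,\quad \partial_\theta\,\mathrm{d}z=-q\,\mathrm{d}z\,\partial_\theta,$$ $$\partial_z\,\mathrm{d}x=\mathrm{d}x\,\partial_z,\quad \partial_z\,\mathrm{d}\xi=-q^{-1}\mathrm{d}\xi\,\partial_z,\quad \partial_z\,\mathrm{d}\theta=-q^{-1}\mathrm{d}\theta\,\partial_z,\quad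 \partial_z\,\mathrm{d}z=\mathrm{d}z\,\partial_z.$$
   Context: The base field is $\mathbb{C}$. $\mathcal{A}_q=\mathcal{A}_q(x,\xi,\theta,z)$ is the $\mathbb{Z}_2\times\mathbb{Z}_2$-graded, associative, unital algebra generated by $x,\xi,\theta,z$ of degrees $(0,0),(0,1),(1,0),(1,1)$ respectively, subject to the relations $$x\xi=q\,\xi x,\quad x\theta=q\,\theta x,\quad xz=zx,\quad \xi^2=0,\quad \theta^2=0,\quad \xi\theta=\theta\xi,\quad \xi z=-q^{-1}z\xi,\quad \theta z=-q^{-1}z\theta.$$ The differential calculus: $\mathrm{d}:\mathcal{A}_q\to\Omega^1(\mathcal{A}_q)$ is a linear map into an $\mathcal{A}_q$-bimodule satisfying $\mathrm{d}(fg)=(\mathrm{d}f)g+f\,\mathrm{d}g$; the one-forms $\mathrm{d}x,\mathrm{d}\xi,\mathrm{d}\theta,\mathrm{d}z$ form a basis of $\Omega^1(\mathcal{A}_q)$ (as a right and as a left $\mathcal{A}_q$-module), and the following commutation rules hold: $$x\,\mathrm{d}x=\mathrm{d}x\,x,\quad x\,\mathrm{d}\xi=q\,\mathrm{d}\xi\,x,\quad x\,\mathrm{d}\theta=q\,\mathrm{d}\theta\,x,\quad x\,\mathrm{d}z=\mathrm{d}z\,x,$$ $$\xi\,\mathrm{d}x=q^{-1}\mathrm{d}x\,\xi,\quad \xi\,\mathrm{d}\xi=-\mathrm{d}\xi\,\xi,\quad \xi\,\mathrm{d}\theta=\mathrm{d}\theta\,\xi,\quad \xi\,\mathrm{d}z=-q^{-1}\mathrm{d}z\,\xi,$$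 $$\theta\,\mathrm{d}x=q^{-1}\mathrm{d}x\,\theta,\quad \theta\,\mathrm{d}\xi=\mathrm{d}\xi\,\theta,\quad \theta\,\mathrm{d}\theta=-\mathrm{d}\theta\,\theta,\quad \theta\,\mathrm{d}z=-q^{-1}\mathrm{d}z\,\theta,$$ $$z\,\mathrm{d}x=\mathrm{d}x\,z,\quad z\,\mathrm{d}\xi=-q\,\mathrm{d}\xi\,z,\quad z\,\mathrm{d}\theta=-q\,\mathrm{d}\theta\,z,\quad z\,\mathrm{d}z=\mathrm{d}z\,z.$$ The partial derivatives on $\mathcal{A}_q$ are the linear maps defined by $\mathrm{d}f=\mathrm{d}x\,\partial_xf+\mathrm{d}\xi\,\partial_\xi f+\mathrm{d}\theta\,\partial_\theta f+\mathrm{d}z\,\partial_zf$. Write $x^a$ for the coordinates $(x,\xi,\theta,z)$ and $\partial_a$ for the corresponding partial derivatives. The $\partial_a$ act on one-forms by differentiating left coefficients, $\partial_a(f\,\mathrm{d}x^c)=(\partial_af)\,\mathrm{d}x^c$ for $f\in\mathcal{A}_q$; in particular $\partial_a(x^b\,\mathrm{d}x^c)=\delta_a^{\ b}\,\mathrm{d}x^c$. The rules in the claim are identities of operators $\mathcal{A}_q\to\Omega^1(\mathcal{A}_q)$, with $\mathrm{d}x^b$ denoting the operator $f\mapsto\mathrm{d}x^b\,f$. *)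

(* Defs.v *)
From HB Require Import structures.
From mathcomp Require Import all_boot all_order all_algebra.
From mathcomp Require Import boolp reals.
From mathcomp Require Import complex.
From mathcomp Require Import monalg.

Set Implicit Arguments.
Unset Strict Implicit.
Unset Printing Implicit Defensive.

Import GRing.Theory.
Local Open Scope ring_scope.
Local Open Scope quotient_scope.

Section IdealQuotient.
Variables (K : fieldType) (A : algType K) (rels : seq A).

(* The two-sided ideal generated by [rels]: finite sums of a * r * b. *)
Inductive rel_ideal : A -> Prop :=
| rel_ideal0 : rel_ideal 0
| rel_idealD u a r b :
    rel_ideal u -> r \in rels -> rel_ideal (u + a * r * b).

Lemma rel_ideal_add u v : rel_ideal u -> rel_ideal v -> rel_ideal (u + v).
Proof.
move=> Iu; elim=> [|w a r b _ IH rR]; first by rewrite addr0.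
by rewrite addrA; apply: rel_idealD.
Qed.

Lemma rel_ideal_mul c u d : rel_ideal u -> rel_ideal (c * u * d).
Proof.
elim=> [|w a r b _ IH rR]; first by rewrite mulr0 mul0r; exact: rel_ideal0.
have -> : c * (w + a * r * b) * d = c * w * d + (c * a) * r * (b * d).
  by rewrite mulrDr mulrDl !mulrA.
exact: rel_idealD.
Qed.

Definition rel_ideal_pred : {pred A} := fun u => `[< rel_ideal u >].

Lemma rel_ideal_zmod_closed : zmod_closed rel_ideal_pred.
Proof.
split; first exact/asboolP/rel_ideal0.
move=> u v /asboolP Iu /asboolP Iv; apply/asboolP/rel_ideal_add => //.
by rewrite -[- v]mulN1r -[_ * v]mulr1; exact: rel_ideal_mul.
Qed.

HB.instance Definition _ :=
  GRing.isZmodClosed.Build A rel_ideal_pred rel_ideal_zmod_closed.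

(* Properness is needed because [algType] only allows nonzero rings. *)
Hypothesis proper : ~ rel_ideal 1.

Definition pres_alg of ~ rel_ideal 1 := Quotient.quot rel_ideal_pred.
Local Notation Q := (pres_alg proper).
HB.instance Definition _ := GRing.Zmodule.on Q.

Definition pres_pi (u : A) : Q := \pi_(Quotient.quot rel_ideal_pred) u.
Definition pres_repr (f : Q) : A := repr (f : Quotient.quot rel_ideal_pred).

Lemma pres_reprK f : pres_pi (pres_repr f) = f.
Proof. exact: reprK. Qed.

Lemma pres_piP u v : pres_pi u = pres_pi v <-> rel_ideal (u - v).
Proof.
split=> [/eqP|I].
  by rewrite /pres_pi -Quotient.idealrBE => /asboolP.
by apply/eqP; rewrite /pres_pi -Quotient.idealrBE; apply/asboolP.
Qed.

Lemma pres_piD : {morph pres_pi : u v / u + v}.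
Proof. by move=> u v; rewrite /pres_pi piE. Qed.

Lemma pres_pi0 : pres_pi 0 = 0.
Proof. by rewrite /pres_pi piE. Qed.

Lemma pres_piN : {morph pres_pi : u / - u}.
Proof. by move=> u; rewrite /pres_pi piE. Qed.

(* The operations are locked to keep unification from unfolding them. *)
Fact pres_key : unit. Proof. exact: tt. Qed.

Definition pres_mul : Q -> Q -> Q := locked_with pres_key
  (fun f g => pres_pi (pres_repr f * pres_repr g)).
Canonical pres_mul_unlockable := [unlockable fun pres_mul].

Definition pres_scale : K -> Q -> Q := locked_with pres_key
  (fun c f => pres_pi (c *: pres_repr f)).
Canonical pres_scale_unlockable := [unlockable fun pres_scale].

Lemma pres_mul_pi u v : pres_mul (pres_pi u) (pres_pi v) = pres_pi (u * v).
Proof.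
rewrite [pres_mul]unlock; apply/pres_piP; set u' := pres_repr _; set v' := pres_repr _.
have -> : u' * v' - u * v = 1 * (u' - u) * v' + u * (v' - v) * 1.
  by rewrite mul1r mulr1 mulrBl mulrBr addrA subrK.
by apply: rel_ideal_add; apply/rel_ideal_mul/pres_piP/pres_reprK.
Qed.

Lemma pres_scale_pi c u : pres_scale c (pres_pi u) = pres_pi (c *: u).
Proof.
rewrite [pres_scale]unlock; apply/pres_piP.
rewrite -scalerBr -[_ - u]mul1r scalerAl -[_ * _]mulr1.
exact/rel_ideal_mul/pres_piP/pres_reprK.
Qed.

Lemma pres_mulA : associative pres_mul.
Proof.
move=> f g h; rewrite -[f]pres_reprK -[g]pres_reprK -[h]pres_reprK.
by rewrite !pres_mul_pi mulrA.
Qed.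

Lemma pres_mul1l : left_id (pres_pi 1) pres_mul.
Proof. by move=> f; rewrite -[f]pres_reprK pres_mul_pi mul1r. Qed.

Lemma pres_mul1r : right_id (pres_pi 1) pres_mul.
Proof. by move=> f; rewrite -[f]pres_reprK pres_mul_pi mulr1. Qed.

Lemma pres_mulDl : left_distributive pres_mul +%R.
Proof.
move=> f g h; rewrite -[f]pres_reprK -[g]pres_reprK -[h]pres_reprK.
by rewrite -pres_piD !pres_mul_pi -pres_piD mulrDl.
Qed.

Lemma pres_mulDr : right_distributive pres_mul +%R.
Proof.
move=> f g h; rewrite -[f]pres_reprK -[g]pres_reprK -[h]pres_reprK.
by rewrite -pres_piD !pres_mul_pi -pres_piD mulrDr.
Qed.

Lemma pres_one_neq0 : pres_pi 1 != 0.
Proof.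
by rewrite -pres_pi0; apply/eqP => /pres_piP; rewrite subr0; exact: proper.
Qed.

HB.instance Definition _ := GRing.Zmodule_isNzRing.Build Q
  pres_mulA pres_mul1l pres_mul1r pres_mulDl pres_mulDr pres_one_neq0.

Lemma pres_scaleA c d f : pres_scale c (pres_scale d f) = pres_scale (c * d) f.
Proof. by rewrite -[f]pres_reprK !pres_scale_pi scalerA. Qed.

Lemma pres_scale1 : left_id 1 pres_scale.
Proof. by move=> f; rewrite -[f]pres_reprK pres_scale_pi scale1r. Qed.

Lemma pres_scaleDr : right_distributive pres_scale +%R.
Proof.
move=> c f g; rewrite -[f]pres_reprK -[g]pres_reprK.
by rewrite -pres_piD !pres_scale_pi -pres_piD scalerDr.
Qed.

Lemma pres_scaleDl f : {morph pres_scale^~ f : c d / c + d}.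
Proof.
by move=> c d; rewrite -[f]pres_reprK !pres_scale_pi -pres_piD scalerDl.
Qed.

HB.instance Definition _ := GRing.Zmodule_isLmodule.Build K Q
  pres_scaleA pres_scale1 pres_scaleDr pres_scaleDl.

Lemma pres_piM : {morph pres_pi : u v / u * v}.
Proof. by move=> u v; rewrite -pres_mul_pi. Qed.

Lemma pres_piZ c : {morph pres_pi : u / c *: u}.
Proof. by move=> u; rewrite -pres_scale_pi. Qed.

Lemma pres_scaleAl (c : K) (f g : Q) : c *: (f * g) = (c *: f) * g.
Proof.
rewrite -[f]pres_reprK -[g]pres_reprK.
by rewrite -pres_piM -!pres_piZ -pres_piM scalerAl.
Qed.

HB.instance Definition _ := GRing.Lmodule_isLalgebra.Build K Q pres_scaleAl.

Lemma pres_scaleAr (c : K) (f g : Q) : c *: (f * g) = f * (c *: g).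
Proof.
rewrite -[f]pres_reprK -[g]pres_reprK.
by rewrite -pres_piM -!pres_piZ -pres_piM scalerAr.
Qed.

HB.instance Definition _ := GRing.Lalgebra_isAlgebra.Build K Q pres_scaleAr.

Lemma pres_rel r : r \in rels -> pres_pi r = 0.
Proof.
move=> rR; rewrite -pres_pi0; apply/pres_piP.
rewrite subr0 -[r]add0r -[r]mul1r -[1 * r]mulr1.
by apply: rel_idealD => //; exact: rel_ideal0.
Qed.

End IdealQuotient.

(* The generators x, xi, theta, z. *)
Inductive gen := gx | gxi | gth | gz.

Definition deg (a : gen) : 'Z_2 * 'Z_2 :=
  match a with
  | gx => (0, 0) | gxi => (0, 1) | gth => (1, 0) | gz => (1, 1)
  end.

(* The four degrees are distinct, so [deg] is a bijection onto Z_2 x Z_2; this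
   inverse only serves to make [gen] a finite type. *)
Definition gen_of_deg (g : 'Z_2 * 'Z_2) : gen :=
  if g.1 == 0 then (if g.2 == 0 then gx else gxi)
  else (if g.2 == 0 then gth else gz).

Lemma degK : cancel deg gen_of_deg. Proof. by case. Qed.

HB.instance Definition _ := Finite.copy gen (can_type degK).

Lemma malg_scalerAr (K : fieldType) (M : monomType) (c : K)
    (u v : {malg K[M]}) : c *: (u * v) = u * (c *: v).
Proof.
apply/malgP => k; rewrite mcoeffZ mcoeffMl.
rewrite (mcoeffMlw (d1 := msupp u) (d2 := msupp v)) ?msuppZ_le //.
rewrite big_distrr /=; apply: eq_bigr => i _.
rewrite big_distrr /=; apply: eq_bigr => j _.
by rewrite mcoeffZ mulrnAr mulrCA.
Qed.

Section Superplane.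
Variables (K : fieldType) (q : K).

(* The free associative unital K-algebra on x, xi, theta, z: the monoid
   algebra of the free monoid. *)
Definition free_alg := {malg K[{fmonom gen}]}.
HB.instance Definition _ := GRing.Lalgebra.on free_alg.

Lemma free_scalerAr (c : K) (u v : free_alg) : c *: (u * v) = u * (c *: v).
Proof. exact: malg_scalerAr. Qed.

HB.instance Definition _ :=
  GRing.Lalgebra_isAlgebra.Build K free_alg free_scalerAr.

Definition free_gen (a : gen) : free_alg := << fmu a >>.

Definition relators (A : algType K) (X : gen -> A) : seq A :=
  let x := X gx in let xi := X gxi in let th := X gth in let z := X gz in
  [:: x * xi - q *: (xi * x);
      x * th - q *: (th * x);
      x * z - z * x;
      xi * xi;
      th * th;
      xi * th - th * xi;
      xi * z - (- (q^-1 *: (z * xi)));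
      th * z - (- (q^-1 *: (z * th)))].

Lemma relators_vanish (A : algType K) (X : gen -> A) (f : A -> K) :
    {morph f : u v / u + v} -> {morph f : u v / u * v} ->
    (forall a, f (X a) = 0) ->
  forall r, r \in relators X -> f r = 0.
Proof.
move=> fD fM fX.
have f0 : f 0 = 0 by apply: (addrI (f 0)); rewrite -fD !addr0.
have fN u : f u = 0 -> f (- u) = 0.
  by move=> u0; apply: (addrI (f u)); rewrite -fD subrr f0 u0 addr0.
have fXX a b : f (X a * X b) = 0 by rewrite fM !fX mulr0.
have fZ c a b : f (c *: (X a * X b)) = 0.
  by rewrite scalerAl fM fX mulr0.
have fB u v : f u = 0 -> f v = 0 -> f (u - v) = 0.
  by move=> u0 v0; rewrite fD u0 fN // addr0.
by move=> r; rewrite !inE; do 7?[case/orP]; move/eqP->;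
  rewrite ?fXX // fB ?fN ?fXX ?fZ.
Qed.

Lemma relators_map (A B : algType K) (X : gen -> A) (f : A -> B) :
    {morph f : u v / u + v} -> {morph f : u / - u} ->
    {morph f : u v / u * v} -> (forall c, {morph f : u / c *: u}) ->
  map f (relators X) = relators (f \o X).
Proof. by move=> fD fN fM fZ; rewrite /relators /= !(fD, fN, fM, fZ). Qed.

Lemma relators_proper : ~ rel_ideal (relators free_gen) 1.
Proof.
pose aug (u : free_alg) : K := mcoeff mone u.
have augD : {morph aug : u v / u + v} by exact: (raddfD (mcoeff mone)).
have augM : {morph aug : u v / u * v} by exact: (rmorphM (mcoeff mone)).
have aug_gen a : aug (free_gen a) = 0.
  by rewrite /aug mcoeffU -(inj_eq val_inj) /= fm1 fmU mulr0n.
have I u : rel_ideal (relators free_gen) u -> aug u = 0.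
  elim=> [|v a r b _ IH rR]; first exact: mcoeff0.
  by rewrite augD IH !augM (relators_vanish augD augM aug_gen rR)
    mulr0 mul0r addr0.
by move=> /I /eqP; rewrite /aug mcoeff1 eqxx oner_eq0.
Qed.

Definition superplane := pres_alg relators_proper.
HB.instance Definition _ := GRing.Algebra.on superplane.

Definition sp_gen (a : gen) : superplane :=
  pres_pi relators_proper (free_gen a).

Lemma sp_relations r : r \in relators sp_gen -> r = 0.
Proof.
have <- := relators_map free_gen (@pres_piD _ _ _ relators_proper)
  (@pres_piN _ _ _ _) (@pres_piM _ _ _ _) (@pres_piZ _ _ _ _).
by move=> /mapP[u uR ->]; exact: pres_rel.
Qed.

(* The Z_2 x Z_2-grading: a class is homogeneous of degree [g] when it is
   represented by a combination of words of total degree [g]. *)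
Definition word_deg (m : {fmonom gen}) : 'Z_2 * 'Z_2 := \sum_(a <- m) deg a.

Definition sp_homog (g : 'Z_2 * 'Z_2) (f : superplane) : Prop :=
  exists2 u : free_alg, f = pres_pi relators_proper u
    & forall m, mcoeff m u != 0 -> word_deg m = g.

End Superplane.

HB.mixin Record Lmodule_isBimodule (K : fieldType) (A : algType K) M
    of GRing.Lmodule A M := {
  rscale : M -> A -> M;
  rscaleDl : forall a, {morph rscale^~ a : u v / u + v};
  rscaleDr : forall u, {morph rscale u : a b / a + b};
  rscale1 : right_id 1 rscale;
  rscaleA : forall u a b, rscale u (a * b) = rscale (rscale u a) b;
  scale_rscaleA : forall a u b, rscale (a *: u) b = a *: rscale u b;
  (* The left and the right action of K coincide. *)
  rscale_alg : forall (k : K) u, rscale u k%:A = k%:A *: u;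
}.

#[short(type="bimodType")]
HB.structure Definition Bimodule (K : fieldType) (A : algType K) :=
  {M of GRing.Lmodule A M & Lmodule_isBimodule K A M}.

Notation "u :*r a" := (rscale u a)
  (at level 40, left associativity, format "u  :*r  a") : ring_scope.

Section Calculus.
Variables (K : fieldType) (q : K).
Local Notation A := (superplane q).
Local Notation X := (sp_gen q).

Record calculus (Omega : bimodType A) := Calculus {
  cdiff :> A -> Omega;
  cdiff_linear : forall (k : K) f g,
    cdiff (k *: f + g) = k%:A *: cdiff f + cdiff g;
  cdiff_leibniz : forall f g, cdiff (f * g) = cdiff f :*r g + f *: cdiff g;
  (* The dx^c form a basis of Omega, as a right and as a left A-module. *)
  cdiff_rbasis : forall w, exists! h : {ffun gen -> A},
    w = \sum_c cdiff (X c) :*r h c;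
  cdiff_lbasis : forall w, exists! h : {ffun gen -> A},
    w = \sum_c h c *: cdiff (X c);
  cdiff_comm_x :
    [/\ X gx *: cdiff (X gx) = cdiff (X gx) :*r X gx,
        X gx *: cdiff (X gxi) = q%:A *: (cdiff (X gxi) :*r X gx),
        X gx *: cdiff (X gth) = q%:A *: (cdiff (X gth) :*r X gx)
      & X gx *: cdiff (X gz) = cdiff (X gz) :*r X gx];
  cdiff_comm_xi :
    [/\ X gxi *: cdiff (X gx) = q^-1%:A *: (cdiff (X gx) :*r X gxi),
        X gxi *: cdiff (X gxi) = - (cdiff (X gxi) :*r X gxi),
        X gxi *: cdiff (X gth) = cdiff (X gth) :*r X gxi
      & X gxi *: cdiff (X gz) = - (q^-1%:A *: (cdiff (X gz) :*r X gxi))];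
  cdiff_comm_th :
    [/\ X gth *: cdiff (X gx) = q^-1%:A *: (cdiff (X gx) :*r X gth),
        X gth *: cdiff (X gxi) = cdiff (X gxi) :*r X gth,
        X gth *: cdiff (X gth) = - (cdiff (X gth) :*r X gth)
      & X gth *: cdiff (X gz) = - (q^-1%:A *: (cdiff (X gz) :*r X gth))];
  cdiff_comm_z :
    [/\ X gz *: cdiff (X gx) = cdiff (X gx) :*r X gz,
        X gz *: cdiff (X gxi) = - (q%:A *: (cdiff (X gxi) :*r X gz)),
        X gz *: cdiff (X gth) = - (q%:A *: (cdiff (X gth) :*r X gz))
      & X gz *: cdiff (X gz) = cdiff (X gz) :*r X gz]
}.

Variables (Omega : bimodType A) (d : calculus Omega).

(* Coordinates of a one-form in the right, resp. left, basis dx^c. *)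
Definition rcoord (w : Omega) : {ffun gen -> A} :=
  projT1 (cid (cdiff_rbasis d w)).

Definition lcoord (w : Omega) : {ffun gen -> A} :=
  projT1 (cid (cdiff_lbasis d w)).

Definition pderiv (a : gen) (f : A) : A := rcoord (d f) a.

(* The action of a partial derivative on one-forms, through their left
   coefficients. *)
Definition pderiv1 (a : gen) (w : Omega) : Omega :=
  \sum_c pderiv a (lcoord w c) *: d (X c).

(* The operator written dx^b in the commutation rules. *)
Definition dmul (b : gen) (f : A) : Omega := d (X b) :*r f.

Lemma rcoordE w : w = \sum_c d (X c) :*r rcoord w c.
Proof. by rewrite /rcoord; case: cid => h []. Qed.

Lemma rcoord_uniq w (h : {ffun gen -> A}) :
  w = \sum_c d (X c) :*r h c -> rcoord w = h.
Proof. by rewrite /rcoord; case: cid => h' /= [_ +]; apply. Qed.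

Lemma lcoordE w : w = \sum_c lcoord w c *: d (X c).
Proof. by rewrite /lcoord; case: cid => h []. Qed.

Lemma lcoord_uniq w (h : {ffun gen -> A}) :
  w = \sum_c h c *: d (X c) -> lcoord w = h.
Proof. by rewrite /lcoord; case: cid => h' /= [_ +]; apply. Qed.

Lemma pderivE f : d f = \sum_c d (X c) :*r pderiv c f.
Proof. exact: rcoordE. Qed.

Lemma rscaleZr (k : K) (u : Omega) (f : A) :
  u :*r (k *: f) = k%:A *: (u :*r f).
Proof. by rewrite -[k *: f]mulr_algl rscaleA rscale_alg scale_rscaleA. Qed.

Lemma rscale0r (u : Omega) : u :*r 0 = 0.
Proof. by apply: (addrI (u :*r 0)); rewrite -rscaleDr !addr0. Qed.

Lemma pderiv_linear a : linear (pderiv a).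
Proof.
move=> k f g; rewrite /pderiv.
have -> // : rcoord (d (k *: f + g))
    = [ffun c => k *: pderiv c f + pderiv c g].
  apply: rcoord_uniq; rewrite cdiff_linear {1}(pderivE f) {1}(pderivE g).
  rewrite scaler_sumr -big_split /=; apply: eq_bigr => c _.
  by rewrite ffunE rscaleDr rscaleZr.
by rewrite ffunE.
Qed.

Lemma pderiv_gen a b : pderiv a (X b) = (a == b)%:R.
Proof.
rewrite /pderiv; have -> : rcoord (d (X b)) = [ffun c => (c == b)%:R].
  apply: rcoord_uniq; rewrite (bigD1 b) //= ffunE eqxx rscale1.
  rewrite big1 ?addr0 // => c /negPf cb.
  by rewrite ffunE cb rscale0r.
by rewrite ffunE.
Qed.

Lemma pderiv0 a : pderiv a 0 = 0.
Proof.
by have := pderiv_linear a (-1) 0 0; rewrite scaleN1r addNr scaleN1r addNr.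
Qed.

Lemma pderiv1_lscale a f c : pderiv1 a (f *: d (X c)) = pderiv a f *: d (X c).
Proof.
rewrite /pderiv1; have -> : lcoord (f *: d (X c)) = [ffun e => f *+ (e == c)].
  apply: lcoord_uniq; rewrite (bigD1 c) //= ffunE eqxx.
  by rewrite big1 ?addr0 // => e /negPf ec; rewrite ffunE ec scale0r.
rewrite (bigD1 c) //= ffunE eqxx big1 ?addr0 // => e /negPf ec.
by rewrite ffunE ec pderiv0 scale0r.
Qed.

Lemma pderiv1D a : {morph pderiv1 a : u v / u + v}.
Proof.
move=> u v; rewrite /pderiv1 -big_split /=; apply: eq_bigr => c _.
have -> : lcoord (u + v) = [ffun e => lcoord u e + lcoord v e].
  apply: lcoord_uniq; rewrite {1}(lcoordE u) {1}(lcoordE v) -big_split /=.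
  by apply: eq_bigr => e _; rewrite ffunE scalerDl.
have := pderiv_linear a 1 (lcoord u c) (lcoord v c).
by rewrite !scale1r ffunE => ->; rewrite scalerDl.
Qed.

End Calculus.

(* Main.v *)
Require Import Defs.
From mathcomp Require Import all_boot all_order all_algebra.
From mathcomp Require Import reals complex.
From mathcomp Require Import monalg.

Import GRing.Theory.
Local Open Scope ring_scope.

Set Implicit Arguments.
Unset Strict Implicit.
Unset Printing Implicit Defensive.

(** All sixteen rules are one rule. If x^a dx^b = c_ab dx^b x^a, with c_ab the scalar [braid a b],
    then ∂_a dx^b = c_ab^-1 dx^b ∂_a ([pderiv1_dmul]). Both sides are linear operators that kill 1,
    so it is enough to compare them on x^e f. There each operator T satisfies T(x^e f) = δ_ae
    c_ab^-1 dx^b f + c_ea c_eb^-1 x^e T(f), and induction on words ([superplane_ind]) concludes.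
    This recursion comes from two facts: moving dx^b past x^e ([dmul_genM]), and the twisted Leibniz
    rule of ∂_a on functions and on one-forms ([pderiv_genM], [pderiv1_genM]). *)

Lemma superplane_ind (K : fieldType) (q : K) (P : superplane q -> Prop) :
  P 1 -> (forall e f, P f -> P (sp_gen q e * f)) ->
  (forall k f g, P f -> P g -> P (k *: f + g)) -> forall f, P f.
Proof.
move=> P1 PM PZD f; pose pi := pres_pi (@relators_proper K q).
have P0 : P 0 by rewrite -(addNr 1) -scaleN1r; exact: PZD.
(* Words grow by one letter on the left; they span the free algebra, so their classes span the
   quotient. *)
have Pword (s : seq gen) : P (pi << FMonom s >>).
  elim: s => [|e s IH]; first by rewrite -fmoneE.
  have -> : << FMonom (e :: s) >> = free_gen K e * << FMonom s >>.
    rewrite /free_gen malgM_def fgmulUU mulr1; congr << _ >>.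
    by apply/val_inj; rewrite /= fmM fmU.
  by rewrite /pi pres_piM; exact: PM.
rewrite -[f]pres_reprK [pres_repr f]monalgE.
elim/big_ind: _ => [|u v Pu Pv|m _].
- by rewrite pres_pi0.
- by rewrite pres_piD -[X in P (X + _)]scale1r; exact: PZD.
set c := mcoeff _ _; have -> : << c *g m >> = c *: << m >> :> free_alg K.
  by apply/malgP => m'; rewrite mcoeffZ !mcoeffU mulr_natr.
rewrite pres_piZ -[_ *: _]addr0; apply: PZD => //.
by case: m {c} => s; exact: Pword.
Qed.

Section Braiding.
Variables (K : fieldType) (q : K).
Hypothesis q_neq0 : q != 0.
Local Notation A := (superplane q).
Local Notation X := (sp_gen q).

(* The scalar in the rule [x^a dx^b = braid a b dx^b x^a]. *)
Definition braid (a b : gen) : K :=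
  match a, b with
  | gx, (gxi | gth) => q
  | (gxi | gth), gx => q^-1
  | gxi, gxi | gth, gth => -1
  | (gxi | gth), gz => - q^-1
  | gz, (gxi | gth) => - q
  | _, _ => 1
  end.

Lemma braid_neq0 a b : braid a b != 0.
Proof. by case: a; case: b; rewrite /= ?oppr_eq0 ?invr_eq0 ?oner_eq0. Qed.

Section Calculus.
Variables (Omega : bimodType A) (d : calculus Omega).

(** Scalars of K act on [Omega] through [k%:A], which is central in the algebra. *)
Lemma scaleAC (k : K) (f : A) (w : Omega) :
  f *: (k%:A *: w) = k%:A *: (f *: w).
Proof. by rewrite !scalerA mulr_algl mulr_algr. Qed.

Lemma scaleAM (k l : K) (w : Omega) :
  k%:A *: (l%:A *: w) = (k * l)%:A *: w.
Proof. by rewrite scalerA mulr_algl scalerA. Qed.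

Lemma scaleA1 (w : Omega) : 1%:A *: w = w.
Proof. by rewrite (scale1r (1 : A)) scale1r. Qed.

Lemma scaleAN (k : K) (w : Omega) : (- k)%:A *: w = - (k%:A *: w).
Proof. by rewrite (scaleNr k (1 : A)) scaleNr. Qed.

Lemma cdiff_comm a b :
  X a *: d (X b) = (braid a b)%:A *: (d (X b) :*r X a).
Proof.
have [xx xxi xth xz] := cdiff_comm_x d.
have [xix xixi xith xiz] := cdiff_comm_xi d.
have [thx thxi thth thz] := cdiff_comm_th d.
have [zx zxi zth zz] := cdiff_comm_z d.
case: a; case: b; rewrite /braid.
- rewrite scaleA1; exact: xx.
- exact: xxi.
- exact: xth.
- rewrite scaleA1; exact: xz.
- exact: xix.
- rewrite scaleAN scaleA1; exact: xixi.
- rewrite scaleA1; exact: xith.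
- rewrite scaleAN; exact: xiz.
- exact: thx.
- rewrite scaleA1; exact: thxi.
- rewrite scaleAN scaleA1; exact: thth.
- rewrite scaleAN; exact: thz.
- rewrite scaleA1; exact: zx.
- rewrite scaleAN; exact: zxi.
- rewrite scaleAN; exact: zth.
- rewrite scaleA1; exact: zz.
Qed.

(** This is the rule x^a dx^b = c_ab dx^b x^a read backwards, hence the inverse. *)
Lemma dmul_genM a b f :
  dmul d b (X a * f) = (braid a b)^-1%:A *: (X a *: dmul d b f).
Proof.
rewrite /dmul -scale_rscaleA cdiff_comm scale_rscaleA scaleAM.
by rewrite mulVf ?braid_neq0 // scaleA1 rscaleA.
Qed.

Lemma dmul_linear b k f g :
  dmul d b (k *: f + g) = k%:A *: dmul d b f + dmul d b g.
Proof. by rewrite /dmul rscaleDr rscaleZr. Qed.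

Lemma dmulZ b k f : dmul d b (k *: f) = k%:A *: dmul d b f.
Proof. exact: rscaleZr. Qed.

Lemma dmul0 b : dmul d b 0 = 0.
Proof. exact: rscale0r. Qed.

Lemma cdiff1 : d 1 = 0.
Proof.
apply: (addrI (d 1)); rewrite addr0 -{3}[1]mulr1.
by rewrite cdiff_leibniz rscale1 scale1r.
Qed.

Lemma pderiv_1 a : pderiv d a 1 = 0.
Proof.
rewrite /pderiv (@rcoord_uniq _ _ _ d _ [ffun=> 0]) ?ffunE // cdiff1.
by rewrite big1 // => c _; rewrite ffunE rscale0r.
Qed.

(** In d(x^e f) = dx^e f + x^e df, moving x^e to the right of each dx^c costs c_ec; right
    coordinates are then compared. *)
Lemma pderiv_genM a e f :
  pderiv d a (X e * f)
    = (a == e)%:R *: f + braid e a *: (X e * pderiv d a f).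
Proof.
rewrite {1}/pderiv (@rcoord_uniq _ _ _ d _
  [ffun c => (c == e)%:R *: f + braid e c *: (X e * pderiv d c f)]) ?ffunE //.
rewrite cdiff_leibniz {1}(pderivE d f) scaler_sumr.
under [RHS]eq_bigr => c _ do rewrite ffunE rscaleDr.
rewrite big_split /=; congr (_ + _).
  rewrite (bigD1 e) //= eqxx scale1r big1 ?addr0 // => c /negPf ->.
  by rewrite scale0r rscale0r.
apply: eq_bigr => c _.
by rewrite -scale_rscaleA cdiff_comm scale_rscaleA -rscaleA rscaleZr.
Qed.

Lemma pderiv1_sum a (h : gen -> A) :
  pderiv1 d a (\sum_c h c *: d (X c)) = \sum_c pderiv d a (h c) *: d (X c).
Proof.
have p0 : pderiv1 d a 0 = 0.
  by apply: (addrI (pderiv1 d a 0)); rewrite -pderiv1D !addr0.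
rewrite (big_morph _ (pderiv1D d a) p0).
by apply: eq_bigr => c _; rewrite pderiv1_lscale.
Qed.

Lemma pderiv1Z a (k : K) w : pderiv1 d a (k%:A *: w) = k%:A *: pderiv1 d a w.
Proof.
rewrite {1}(lcoordE d w) scaler_sumr.
under eq_bigr => c _ do rewrite scalerA mulr_algl.
rewrite pderiv1_sum /pderiv1 scaler_sumr; apply: eq_bigr => c _.
have := pderiv_linear d a k (lcoord d w c) 0; rewrite pderiv0 !addr0 => ->.
by rewrite scalerA mulr_algl.
Qed.

(** Multiplying by x^e on the left multiplies every left coefficient by x^e, so the rule for
    functions applies to each of them. *)
Lemma pderiv1_genM a e w :
  pderiv1 d a (X e *: w)
    = (a == e)%:R%:A *: w + (braid e a)%:A *: (X e *: pderiv1 d a w).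
Proof.
rewrite {1 2}(lcoordE d w) !scaler_sumr.
under eq_bigr => c _ do rewrite scalerA.
rewrite pderiv1_sum -big_split; apply: eq_bigr => c _ /=.
by rewrite pderiv_genM scalerDl !scalerA !mulr_algl.
Qed.

(* Both sides obey the same twisted Leibniz rule with respect to left
   multiplication by a generator, and both vanish on [1]. *)
Lemma pderiv1_dmul a b f :
  pderiv1 d a (dmul d b f) = (braid a b)^-1%:A *: dmul d b (pderiv d a f).
Proof.
elim/superplane_ind: f => [|e f IH|k f g IHf IHg].
(* Here dx^b = 1 dx^b has constant left coefficient, which ∂_a kills. *)
- rewrite pderiv_1 dmul0 scaler0 /dmul rscale1 -[d _]scale1r.
  by rewrite pderiv1_lscale pderiv_1 scale0r.
- rewrite dmul_genM pderiv1Z pderiv1_genM IH pderiv_genM.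
  rewrite dmul_linear dmulZ dmul_genM !(scalerDr (_%:A)) (scaleAC _ (X e)).
  (* Nested scalars are collected in front of each term, leaving only coefficients to compare. *)
  rewrite 2![X in _ + X = _]scaleAM 2![X in _ = _ + X]scaleAM.
  rewrite [X in X + _ = _]scaleAM [X in _ = X + _]scaleAM.
  congr (_%:A *: _ + _%:A *: _).
    (* The delta survives only for e = a, where c_eb and c_ab coincide. *)
    by case: eqP => [->|_]; rewrite ?mulr0.
  by rewrite mulrC (mulrC (braid e b)^-1) mulrA.
- by rewrite dmul_linear pderiv1D pderiv1Z IHf IHg pderiv_linear dmul_linear
    scalerDr scaleAC.
Qed.

End Calculus.
End Braiding.

Theorem proposition5 (R : realType) (q : R[i])
    (q_neq0 : q != 0) (q_nroot : forall n : nat, (0 < n)%N -> q ^+ n != 1)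
    (Omega : bimodType (superplane q)) (d : calculus Omega)
    (f : superplane q) :
  [/\
   [/\ pderiv1 d gx (dmul d gx f) = dmul d gx (pderiv d gx f),
       pderiv1 d gx (dmul d gxi f) = q^-1%:A *: dmul d gxi (pderiv d gx f),
       pderiv1 d gx (dmul d gth f) = q^-1%:A *: dmul d gth (pderiv d gx f)
     & pderiv1 d gx (dmul d gz f) = dmul d gz (pderiv d gx f)],
   [/\ pderiv1 d gxi (dmul d gx f) = q%:A *: dmul d gx (pderiv d gxi f),
       pderiv1 d gxi (dmul d gxi f) = - dmul d gxi (pderiv d gxi f),
       pderiv1 d gxi (dmul d gth f) = dmul d gth (pderiv d gxi f)
     & pderiv1 d gxi (dmul d gz f) = - (q%:A *: dmul d gz (pderiv d gxi f))],
   [/\ pderiv1 d gth (dmul d gx f) = q%:A *: dmul d gx (pderiv d gth f),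
       pderiv1 d gth (dmul d gth f) = - dmul d gth (pderiv d gth f),
       pderiv1 d gth (dmul d gxi f) = dmul d gxi (pderiv d gth f)
     & pderiv1 d gth (dmul d gz f) = - (q%:A *: dmul d gz (pderiv d gth f))]
 & [/\ pderiv1 d gz (dmul d gx f) = dmul d gx (pderiv d gz f),
       pderiv1 d gz (dmul d gxi f) = - (q^-1%:A *: dmul d gxi (pderiv d gz f)),
       pderiv1 d gz (dmul d gth f) = - (q^-1%:A *: dmul d gth (pderiv d gz f))
     & pderiv1 d gz (dmul d gz f) = dmul d gz (pderiv d gz f)]].
Proof.
have deriv_dmul := pderiv1_dmul q_neq0 d.
(* Each rule is the general one with the inverse of [braid a b] evaluated. *)
by split; split;
  rewrite deriv_dmul /= ?(invr1, invrN, invrK) ?scaleAN ?scaleA1.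
Qed.
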